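(* For every integer $k\geq1$, \[b_{2,k}(k)=\begin{cases}\frac{k+1}{2} & \text{if } k\equiv1\pmod 2,\\ \frac{k}{2} & \text{if } k\equiv 0\pmod 2,\end{cases}\qquad b_{2,k}(k+1)=\begin{cases}1 & \text{if } k\equiv1\pmod 2,\\ 2 & \text{if } k\equiv 0\pmod 2.\end{cases}\]
   Context: A $2$-regular partition of $n$ is a partition of $n$ with no even parts. The hook length of a box in the Young diagram of a partition (rows of lengths $\lambda_1\geq\lambda_2\geq\cdots$, left-justified) is the number of boxes directly to its right plus the number directly below it plus $1$. For $k\geq1$, $b_{2,k}(n)$ denotes the total number of boxes of hook length $k$, counted over all $2$-regular partitions of $n$. *)

(* Defs.v *)
From mathcomp Require Import all_boot.

Set Implicit Arguments.
Unset Strict Implicit.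
Unset Printing Implicit Defensive.

(* A partition is the sequence of its parts in non-increasing order. *)
Definition is_partition_of (n : nat) (s : seq nat) : bool :=
  [&& sorted geq s, 0 \notin s & sumn s == n].

Definition two_regular (s : seq nat) : bool := all odd s.

(* The box in row i and column j, both numbered from 0, is the pair (i, j);
   row i has length nth 0 s i. *)
Definition boxes (s : seq nat) : seq (nat * nat) :=
  [seq (i, j) | i <- iota 0 (size s), j <- iota 0 (nth 0 s i)].

Definition arm (s : seq nat) (c : nat * nat) : nat :=
  count (fun d => (d.1 == c.1) && (c.2 < d.2)) (boxes s).

Definition leg (s : seq nat) (c : nat * nat) : nat :=
  count (fun d => (c.1 < d.1) && (d.2 == c.2)) (boxes s).

Definition hook_length (s : seq nat) (c : nat * nat) : nat :=
  arm s c + leg s c + 1.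

Definition num_hooks (k : nat) (s : seq nat) : nat :=
  count (fun c => hook_length s c == k) (boxes s).

(* {bseq n of 'I_n.+1} is the finite type of sequences of at most n numbers,
   each at most n. Every partition of n is the image of exactly one of them:
   see partition_bseq and parts_inj. *)
Definition parts (n : nat) (b : {bseq n of 'I_n.+1}) : seq nat :=
  [seq val x | x <- b].

Lemma parts_inj n : injective (@parts n).
Proof. by move=> b c /(inj_map val_inj) ?; apply: val_inj. Qed.

Lemma partition_bseq n s :
  is_partition_of n s -> exists b : {bseq n of 'I_n.+1}, parts b = s.
Proof.
case/and3P=> _ s_n0 /eqP sum_s.
have size_s : size s <= n.
  rewrite -sum_s {sum_s}; elim: s s_n0 => //= x s IHs.
  rewrite inE negb_or eq_sym -lt0n => /andP[x_gt0 /IHs IH].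
  by rewrite -add1n leq_add.
have le_s x : x \in s -> x <= n.
  rewrite -sum_s {s_n0 sum_s size_s}; elim: s => //= y s IHs.
  rewrite inE => /predU1P[->|/IHs IH]; first exact: leq_addr.
  exact: leq_trans IH (leq_addl _ _).
have size_b : size [seq inord x : 'I_n.+1 | x <- s] <= n by rewrite size_map.
exists (Bseq size_b); rewrite /parts /= -map_comp -[RHS]map_id.
by apply/eq_in_map => x /le_s x_le /=; rewrite inordK.
Qed.

Definition b2 (k n : nat) : nat :=
  \sum_(b : {bseq n of 'I_n.+1} |
        is_partition_of n (parts b) && two_regular (parts b))
    num_hooks k (parts b).

(* Main.v *)
(** Deleting the first row of a diagram does not change the hooks of the other
    boxes, and no hook is longer than the number of boxes.  Hence a partition of
    [k] has a box of hook length [k] only at its corner, and only if all its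
    parts but the first equal [1].  In a partition of [k + 1], a hook of
    length [k] misses exactly one box.  If the hook starts at the corner, that
    box is [(1, 1)], so that some part is [2]; otherwise the missed box is the
    corner, and the partition is a single row or a single column. *)
Require Import Defs.
From mathcomp Require Import all_boot.
From mathcomp Require Import zify.

Lemma boxes_cons x s :
  boxes (x :: s) =
  [seq (0, j) | j <- iota 0 x] ++ [seq (c.1.+1, c.2) | c <- boxes s].
Proof.
rewrite /boxes /= map_allpairs; congr (_ ++ _).
by rewrite (iotaDl 1 0) -map_comp.
Qed.

(** [count (ltn j) s] is the part of index [j] of the conjugate partition; legs are expressed
    through it from here on. *)
Lemma count_column j s :
  count (fun d => d.2 == j) (boxes s) = count (ltn j) s.
Proof.
elim: s => [//|x s IHs]; rewrite boxes_cons count_cat !count_map /=.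
rewrite -[in RHS]IHs; congr (_ + _).
by have:= count_uniq_mem j (iota_uniq 0 x); rewrite mem_iota add0n => <-.
Qed.

Lemma count_gt_iota j x : count (ltn j) (iota 0 x) = x - j.+1.
Proof.
elim: x => [//|x IHx]; rewrite -addn1 iotaD count_cat IHx /= add0n; lia.
Qed.

Lemma hook_length_row0 x s j :
  j < x -> hook_length (x :: s) (0, j) = x - j + count (ltn j) s.
Proof.
move=> lt_jx; rewrite /hook_length /arm /leg boxes_cons !count_cat !count_map.
rewrite -count_column -[x - j](@subnSK j x) // -(count_gt_iota j x).
rewrite (@eq_count _ _ pred0 _ (boxes s)) // count_pred0.
rewrite [X in _ + (X + _)](@eq_count _ _ pred0) // count_pred0.
by rewrite addn0 addn1 add0n addSn.
Qed.

Lemma hook_length_succ x s c :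
  hook_length (x :: s) (c.1.+1, c.2) = hook_length s c.
Proof.
rewrite /hook_length /arm /leg boxes_cons !count_cat !count_map.
by rewrite (@eq_count _ _ pred0 _ (iota 0 x)) // count_pred0.
Qed.

Lemma num_hooks_cons k x s :
  num_hooks k (x :: s) =
  count (fun j => x - j + count (ltn j) s == k) (iota 0 x) + num_hooks k s.
Proof.
rewrite /num_hooks boxes_cons count_cat !count_map; congr (_ + _).
  apply: eq_in_count => j; rewrite mem_iota => /= lt_jx.
  by rewrite hook_length_row0.
by apply: eq_count => c /=; rewrite hook_length_succ.
Qed.

(** Each part exceeding [j] contributes at least [j.+1] boxes. This bounds the leg in every hook
    estimate below. *)
Lemma count_ltn_sumn j s : j.+1 * count (ltn j) s <= sumn s.
Proof.
by elim: s => [|x s IHs] /=; [rewrite muln0 | case: ltnP; nia].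
Qed.

Lemma num_hooks_small k s : sumn s < k -> num_hooks k s = 0.
Proof.
elim: s => [|x s IHs] //= lt_sk; rewrite num_hooks_cons IHs; last lia.
rewrite addn0; apply/eqP; rewrite -leqn0 leqNgt -has_count.
apply/hasP => -[j]; rewrite mem_iota => lt_jx /eqP.
by have := count_ltn_sumn j s; nia.
Qed.

Lemma sumn_eq_size s : 0 \notin s -> (sumn s == size s) = (s == nseq (size s) 1).
Proof.
move=> s_n0; apply/eqP/eqP => [|->]; last by rewrite sumn_nseq size_nseq mul1n.
elim: s s_n0 => //= x s IHs; rewrite inE negb_or => /andP[x0 s0] e.
have le : size s <= sumn s.
  elim: s s0 {IHs e} => //= y s IHs; rewrite inE negb_or => /andP[y0 /IHs]; lia.
have e1 : x = 1 by lia.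
by rewrite e1 -IHs //; lia.
Qed.

Lemma count_ltn0 s : 0 \notin s -> count (ltn 0) s = size s.
Proof.
by elim: s => //= x s IHs; rewrite inE negb_or => /andP[x0 /IHs->]; lia.
Qed.

Lemma num_hooks_self k x s :
  0 \notin x :: s -> sumn (x :: s) = k ->
  num_hooks k (x :: s) = (s == nseq (size s) 1).
Proof.
rewrite inE negb_or => /andP[x0 s0] /= sum_k.
rewrite num_hooks_cons num_hooks_small; last lia.
case: x x0 sum_k => // x _ sum_k; rewrite /= addn0 count_ltn0 //.
(* Right of the corner the arm is shorter and the leg is still at most [sumn s], so the hook is
   shorter than [k]. *)
rewrite (@eq_in_count _ _ pred0 (iota 1 x)) ?count_pred0; last first.
  move=> j; rewrite mem_iota => lt_j /=.
  by have := count_ltn_sumn j s; nia.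
by rewrite -sumn_eq_size //; lia.
Qed.

Lemma odd_sumn s : all odd s -> odd (sumn s) = odd (size s).
Proof. by elim: s => //= x s IHs /andP[ox /IHs]; rewrite oddD ox => ->. Qed.

Lemma sorted_geq_1 s : 0 \notin s -> path geq 1 s -> s = nseq (size s) 1.
Proof.
elim: s => //= x s IHs; rewrite inE negb_or => /andP[x0 s0] /andP[x1].
have -> : x = 1 by lia.
by move=> /(IHs s0) <-.
Qed.

Lemma num_hooks_pred k s :
  0 < k -> is_partition_of k.+1 s -> two_regular s ->
  num_hooks k s = (s == [:: k.+1]) + (s == nseq k.+1 1).
Proof.
move=> k0 /and3P[]; case: s => [//|x s] /= ps.
rewrite inE negb_or => /andP[x0 s0] /eqP sum_k /andP[ox os].
rewrite num_hooks_cons; case: x x0 ps ox sum_k => // x _ ps ox sum_k.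
have par := odd_sumn _ os.
rewrite /= count_ltn0 // subn0 -!addnA.
(* A corner hook of length [k] would give [sumn s] and [size s] opposite parities, impossible for
   odd parts. *)
have -> : (x.+1 + size s == k) = false.
  apply/eqP => e; have e1 : sumn s = (size s).+1 by lia.
  by move: par; rewrite e1 /=; case: odd.
rewrite add0n.
case: x ps ox sum_k => [|x] ps ox sum_k.
  (* First part 1: the partition is a column, and its tail is a column of [k] boxes whose corner has
     the only hook of length [k]. *)
  have es := sorted_geq_1 _ s0 ps.
  have sk : sumn s = k by lia.
  have sz : size s = k by rewrite -sk es sumn_nseq size_nseq mul1n.
  rewrite /= add0n !eqseq_cons /= eqSS -sz -es eqxx /=.
  case: s s0 ps os sum_k par es sk sz => [|y s] s0 ps os sum_k par es sk sz.
    by move: k0; rewrite -sz.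
  rewrite num_hooks_self //; last by rewrite sk sz.
  by move: es => /= [_ <-]; rewrite eqxx.
rewrite num_hooks_small /=; last lia.
(* From column 2 on, the hook misses at least the first two boxes of row 0, so it is too short. *)
rewrite addn0 (@eq_in_count _ _ pred0 (iota 2 x)) ?count_pred0; last first.
  move=> j; rewrite mem_iota => lt_j /=.
  by have := count_ltn_sumn j s; nia.
rewrite !eqseq_cons !addn0 /=; congr nat_of_bool.
apply/eqP/andP => [e|[/eqP e /eqP->]]; last by rewrite /=; lia.
(* In column 1, hook length [k] forces the leg to equal [sumn s]; twice the leg is at most [sumn s],
   so nothing lies below the first row. *)
have := count_ltn_sumn 1 s => le.
have s_0 : sumn s = 0 by lia.
have kx : x.+2 == k.+1 by lia.
case: s s0 s_0 {ps os sum_k par e le} => [//|y s].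
by rewrite inE negb_or /=; lia.
Qed.

(** Reduces the sum to an explicit list [L] of the contributing partitions: [parts] is injective and
    reaches every partition, so the nonzero terms are a permutation of [L]. *)
Lemma sum_parts n (P : pred (seq nat)) (F : seq nat -> nat) (L : seq (seq nat)) :
  uniq L -> (forall s, s \in L -> P s && (F s != 0)) ->
  (forall s, P s -> is_partition_of n s) ->
  (forall s, P s -> F s != 0 -> s \in L) ->
  \sum_(b : {bseq n of 'I_n.+1} | P (parts b)) F (parts b) = \sum_(s <- L) F s.
Proof.
move=> uL LP Ppart PL.
rewrite (bigID (fun b => F (parts b) != 0)) /= addnC big1 ?add0n; last first.
  by move=> b /andP[_ /negbNE/eqP].
rewrite -big_filter -(big_map (@parts n) predT).
apply: perm_big; apply: uniq_perm => //.
  by rewrite (map_inj_uniq (@parts_inj n)) filter_uniq ?index_enum_uniq.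
move=> s; apply/mapP/idP => [[b]|sL].
  by rewrite mem_filter => /andP[/andP[Pb Fb] _] ->; apply: PL.
have /andP[Ps Fs] := LP s sL; have [b eb] := partition_bseq (Ppart s Ps).
by exists b; rewrite ?mem_filter ?eb ?Ps ?Fs ?mem_index_enum.
Qed.

Lemma partition_of_hook a m : 0 < a -> is_partition_of (a + m) (a :: nseq m 1).
Proof.
move=> a0; rewrite /is_partition_of /= sumn_nseq mul1n eqxx andbT inE.
apply/andP; split; last by rewrite mem_nseq andbF orbF; lia.
by elim: m a a0 => //= m IHm a a0; rewrite IHm // andbT.
Qed.

Lemma count_odd_iota k : count odd (iota 1 k) = uphalf k.
Proof.
elim: k => [//|k IHk]; rewrite -(addn1 k) iotaD count_cat IHk /=; lia.
Qed.

Lemma b2_self k : 0 < k -> b2 k k = uphalf k.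
Proof.
(* The contributing partitions are the hook-shaped ones with odd first part [a], each counted
   once. *)
move=> k0; pose hook a := a :: nseq (k - a) 1.
pose L := [seq hook a | a <- iota 1 k & odd a].
have Lk s : s \in L ->
    [/\ is_partition_of k s, two_regular s & num_hooks k s = 1].
  case/mapP => a; rewrite mem_filter mem_iota => /andP[oa lt_a] ->.
  have pa : is_partition_of k (hook a).
    by rewrite -{1}(@subnKC a k) ?partition_of_hook; lia.
  split=> //; first by rewrite /two_regular /= oa all_nseq orbT.
  by case/and3P: pa => _ ha /eqP /num_hooks_self ->; rewrite // size_nseq eqxx.
rewrite /b2 (@sum_parts _ (fun s => is_partition_of k s && two_regular s) _ L).
- under eq_big_seq => s /Lk[_ _ ->] do [].
  by rewrite sum1_size size_map size_filter count_odd_iota.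
- by rewrite map_inj_uniq ?filter_uniq ?iota_uniq // => a b [].
- by move=> s /Lk[-> -> ->].
- by move=> s /andP[].
move=> [|x s] /andP[/and3P[_ s0 /eqP sum_k]].
  by move: k0; rewrite -sum_k.
case/andP=> ox _.
rewrite num_hooks_self // eqb0 negbK => /eqP es.
apply/mapP; exists x.
  by rewrite mem_filter ox mem_iota; move: s0 sum_k; rewrite inE negb_or /=; lia.
by rewrite /hook -sum_k {1}es [in RHS]es /= sumn_nseq mul1n addKn.
Qed.

Lemma b2_succ k : 0 < k -> b2 k k.+1 = if odd k then 1 else 2.
Proof.
(* The column always has odd parts, the row only for even [k]; the two differ because [k] is
   positive. *)
move=> k0; pose L := nseq k.+1 1 :: (if odd k then [::] else [:: [:: k.+1]]).
have neq : (nseq k.+1 1 == [:: k.+1]) = false by case: k k0 {L}.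
have pn : is_partition_of k.+1 (nseq k.+1 1) by apply: (@partition_of_hook 1 k).
have p1 : is_partition_of k.+1 [:: k.+1].
  by have := @partition_of_hook k.+1 0 isT; rewrite addn0.
have rn : two_regular (nseq k.+1 1) by rewrite /two_regular all_nseq orbT.
have r1 : two_regular [:: k.+1] = ~~ odd k by rewrite /two_regular /= andbT.
have Lk s : s \in L ->
    [/\ is_partition_of k.+1 s, two_regular s & num_hooks k s = 1].
  rewrite inE => /predU1P[->|].
    by split=> //; rewrite num_hooks_pred // neq eqxx.
  case: ifP => // /negbT nk; rewrite inE => /eqP->.
  by rewrite r1; split=> //; rewrite num_hooks_pred ?r1 // eqxx eq_sym neq.
rewrite /b2 (@sum_parts _ (fun s => is_partition_of k.+1 s && two_regular s) _ L).
- under eq_big_seq => s /Lk[_ _ ->] do [].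
  by rewrite sum1_size /L; case: odd.
- by rewrite /L; case: odd => //; rewrite cons_uniq inE neq.
- by move=> s /Lk[-> -> ->].
- by move=> s /andP[].
move=> s /andP[ps rs]; rewrite num_hooks_pred // /L inE.
have [-> // | _] := eqVneq s (nseq k.+1 1); rewrite addn0 eqb0 negbK => /eqP es.
by move: rs; rewrite es r1 => /negbTE ->; rewrite inE eqxx orbT.
Qed.

Theorem theorem1p6 (k : nat) (hk : 1 <= k) :
  b2 k k = (if k == 1 %[mod 2] then (k + 1) %/ 2 else k %/ 2) /\
  b2 k (k + 1) = (if k == 1 %[mod 2] then 1 else 2).
Proof.
rewrite addn1 b2_self // b2_succ // modn2 eqb1.
by split=> //; case: ifP; lia.
Qed.
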